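(* Let $(Z,\mathcal{G}_Z)$ be an affine convex geometry. The following statements are equivalent: (1) $(Z,\mathcal{G}_Z)$ is resolvable; (2) there is a shrinkable subset $S$ of $Z$; (3) there is an extremely shrinkable subset $S$ of $Z$; (4) there is a subset $S$ of $Z$, with $1<|S|<|Z|$, satisfying the following two properties: (V1) for all $G\in\mathcal{G}_Z$, if $|G\cap S|=1$ then $G\cup S\in\mathcal{G}_Z$; (V2) for all $H\in\mathcal{G}_Z$, $(Z\setminus S)\cup(H\cap S)\in\mathcal{G}_Z$.
   Context: A convex geometry on a finite nonempty set $X$ is a family $\mathcal{G}\subseteq 2^X$ such that: (G1) $\varnothing\in\mathcal{G}$; (G2) if $F,G\in\mathcal{G}$ then $F\cap G\in\mathcal{G}$; (G3) for every $G\in\mathcal{G}\setminus\{X\}$ there is $x\in X\setminus G$ with $G\cup\{x\}\in\mathcal{G}$. The pair $(X,\mathcal{G})$ is also called a convex geometry. For $A\subseteq X$, the convex hull is $\operatorname{conv}_{\mathcal{G}}(A)=\bigcap\{G\in\mathcal{G}: A\subseteq G\}$, and the set of extreme elements of $A$ is $\operatorname{ex}_{\mathcal{G}}(A)=\{a\in A: a\notin\operatorname{conv}_{\mathcal{G}}(A\setminus\{a\})\}$. Two convex geometries $(X,\mathcal{G}_X)$, $(Y,\mathcal{G}_Y)$ are isomorphic if there is a bijection $\sigma\colon X\to Y$ with $A\in\mathcal{G}_X\iff\sigma(A)\in\mathcal{G}_Y$ for all $A\subseteq X$. A convex geometry is affine if it is isomorphic to one of the form $(X,\{X\cap C: C\text{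 a convex subset of }\mathbb{R}^d\})$ for some $d$ and some nonempty finite $X\subset\mathbb{R}^d$. Resolution: let $(X,\mathcal{G}_X)$ be a convex geometry (the base) and $\{(Y_x,\mathcal{G}_x):x\in X\}$ a family of convex geometries (the fibers), where the sets $Y_x$ are pairwise disjoint and disjoint from $X$. Let $Z=\bigcup_{x\in X}Y_x$ and let $\pi\colon Z\to X$ be the projection given by $\pi(z)=x$ for $z\in Y_x$. The resolution of $(X,\mathcal{G}_X)$ into $\{(Y_x,\mathcal{G}_x):x\in X\}$ is the pair $(Z,\mathcal{G}_Z)$, where $\mathcal{G}_Z$ consists of all $A\subseteq Z$ such that: (R1) $\pi(A)\in\mathcal{G}_X$; (R2) $A\cap Y_x\in\mathcal{G}_x$ for all $x\in\pi(A)$; (R3) $Y_x\subseteq A$ for all $x\in\pi(A)\setminus\operatorname{ex}_{\mathcal{G}_X}(\pi(A))$. The resolution is again a convex geometry. It is nontrivial if both the base and at least one fiber have more than one element. It is extreme if $|Y_x|=1$ for each $x\in X\setminus\operatorname{ex}_{\mathcal{G}_X}(X)$. A convex geometry is resolvable if it equals some nontrivial resolution of convex geometries. A subset $S$ of $Z$ is shrinkable in $(Z,\mathcal{G}_Z)$ if $|S|\ge 2$ and $S$ is a fiber in some nontrivial resolution equal to $(Z,\mathcal{G}_Z)$; it is extremely shrinkable if $|S|\ge2$ and $S$ is a fiber in some nontrivial extreme resolution equal to $(Z,\mathcal{G}_Z)$. *)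

(* Defs.v *)
From mathcomp Require Import all_boot all_order all_algebra finmap.
From mathcomp Require Import boolp reals convex.
From mathcomp Require classical_sets.

Set Implicit Arguments.
Unset Strict Implicit.
Unset Printing Implicit Defensive.

(* The ground set X is a subset of an ambient finite type T rather than T
   itself, so that the fibers of a resolution can live on subsets of Z. *)
Definition convex_geometry (T : finType) (X : {set T}) (G : {set {set T}}) :
    Prop :=
  [/\ X != set0,
      forall F, F \in G -> F \subset X,
      set0 \in G,
      forall F1 F2, F1 \in G -> F2 \in G -> F1 :&: F2 \in G
    & forall F, F \in G -> F != X ->
        exists2 x, x \in X :\: F & x |: F \in G].

(* An empty intersection is the whole type T here; it does not occur when G is
   a convex geometry on X and A \subset X, because then X \in G. *)
Definition cg_hull (T : finType) (G : {set {set T}}) (A : {set T}) : {set T} :=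
  \bigcap_(F in G | A \subset F) F.

Definition cg_extreme (T : finType) (G : {set {set T}}) (A : {set T}) :
    {set T} :=
  [set a in A | a \notin cg_hull G (A :\ a)].

Definition cg_isomorphic (T U : finType)
    (GT : {set {set T}}) (GU : {set {set U}}) : Prop :=
  exists2 s : T -> U, bijective s &
    forall A : {set T}, (A \in GT) <-> (s @: A \in GU).

Definition point_geometry (R : realType) (d : nat) (P : {fset 'rV[R]_d}) :
    {set {set P}} :=
  [set A : {set P} | `[< exists2 C : classical_sets.set 'rV[R]_d,
     convex_set C & A = [set p : P | `[< C (val p) >]] >]].

Definition affine_geometry (R : realType) (T : finType) (G : {set {set T}}) :
    Prop :=
  exists (d : nat) (P : {fset 'rV[R]_d}),
    P != fset0 /\ cg_isomorphic G (point_geometry P).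

(* The base lives on a type of its own, which makes it disjoint from the
   fibers. *)
Record resolution (T : finType) := Resolution {
  base : finType;
  base_geom : {set {set base}};
  fiber : base -> {set T};
  fiber_geom : base -> {set {set T}};
  base_geomP : convex_geometry [set: base] base_geom;
  fiber_geomP : forall x, convex_geometry (fiber x) (fiber_geom x);
  fiber_disjoint : forall x y, x != y -> [disjoint fiber x & fiber y]
}.

Section Resolution.
Variables (T : finType) (r : resolution T).

Definition res_ground : {set T} := \bigcup_(x : base r) fiber x.

Definition res_proj (A : {set T}) : {set base r} :=
  [set x | [exists z in A, z \in fiber x]].

Definition res_geom : {set {set T}} :=
  [set A : {set T} |
    [&& A \subset res_ground,
        res_proj A \in base_geom r,
        [forall x in res_proj A, A :&: fiber x \in fiber_geom x]
      & [forall x in res_proj A :\: cg_extreme (base_geom r) (res_proj A),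
           fiber x \subset A]]].

Definition res_equals (Z : {set T}) (G : {set {set T}}) : Prop :=
  res_ground = Z /\ res_geom = G.

Definition res_nontrivial : Prop :=
  1 < #|base r| /\ exists x : base r, 1 < #|fiber x|.

Definition res_extreme : Prop :=
  forall x : base r,
    x \notin cg_extreme (base_geom r) [set: base r] -> #|fiber x| = 1.

Definition is_fiber (S : {set T}) : Prop := exists x : base r, S = fiber x.

End Resolution.

Definition resolvable (T : finType) (Z : {set T}) (G : {set {set T}}) : Prop :=
  exists r : resolution T, res_equals r Z G /\ res_nontrivial r.

Definition shrinkable (T : finType) (Z : {set T}) (G : {set {set T}})
    (S : {set T}) : Prop :=
  2 <= #|S| /\ exists r : resolution T,
    [/\ res_equals r Z G, res_nontrivial r & is_fiber r S].

Definition extremely_shrinkable (T : finType) (Z : {set T})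
    (G : {set {set T}}) (S : {set T}) : Prop :=
  2 <= #|S| /\ exists r : resolution T,
    [/\ res_equals r Z G, res_nontrivial r, res_extreme r & is_fiber r S].

(* Main.v *)
Require Import Defs.
From mathcomp Require Import all_boot all_order all_algebra finmap.
From mathcomp Require Import boolp reals convex.
From mathcomp Require classical_sets.
From mathcomp Require Import interval_inference ring.

Set Implicit Arguments.
Unset Strict Implicit.
Unset Printing Implicit Defensive.

(** The delicate implication is that a nontrivial resolution of an affine
    geometry is extreme ([exchange_res_extreme]); hence every shrinkable set is
    extremely shrinkable, with the same resolution. Two features of affine
    geometries are used: points are closed, and hulls have the exchange property
    of [affine_exchange], namely that if [s] and [t] lie in the hull of [B], then
    [s] lies in the hull of [B] with some point replaced by [t]. Geometrically,
    the pyramids with apex [t] over the facets of a polytope containing [t] cover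
    that polytope.

    Suppose that [x] is not extreme in the base but that its fiber contains two
    points [s] and [t]. Choose a minimal set [A] of base points, without [x],
    whose hull contains [x], and one point of [Z] over each element of [A].
    Axiom (R3) puts the whole fiber of [x] in the hull of the chosen points. By
    exchange, [s] is in the hull of [t] and of the chosen points over [A :\ a],
    for some [a]. By minimality of [A], the point [x] is outside the hull of
    [A :\ a], so there is a closed set [E] which contains [A :\ a], avoids [x],
    and stays closed when [x] is added. As [x] is then extreme in [x |: E], the
    preimage of [E] together with [t] is closed in [Z]. It contains the points
    spanning [s] and its only point over [x] is [t], so [s = t].

    For an extreme base point, (V1) and (V2) are read off the definition of a
    resolution ([fiber_V1], [fiber_V2]). Conversely, (V1) and (V2) allow [S] to
    be contracted to one point: the images of the closed sets form the base, the
    traces of the closed sets on [S] and on the remaining points form the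
    fibers, and this resolution is [G] ([squeeze_res_geom]). The key fact is
    that a closed set meeting [S] stays closed when [S] is added
    ([saturated_closed]). *)

(** * Hulls and traces in convex geometries *)

Lemma hullP (T : finType) (G : {set {set T}}) (A : {set T}) (z : T) :
  reflect (forall F, F \in G -> A \subset F -> z \in F) (z \in cg_hull G A).
Proof.
apply: (iffP bigcapP) => [H F GF AF|H F /andP[GF AF]]; last exact: H.
by apply: H; rewrite GF.
Qed.

Section ConvexGeometry.
Variables (T : finType) (X : {set T}) (G : {set {set T}}).
Hypothesis cgG : convex_geometry X G.

(** The relative form of the axiom (G3): a maximal closed set with the same trace
    as [F] on [S] can only be enlarged by a point of [S]. *)
Lemma cg_trace_step (F S : {set T}) :
  S \subset X -> F \in G -> F :&: S != S ->
  exists x (E : {set T}), [/\ x \in S :\: F, E \in G & E :&: S = x |: F :&: S].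
Proof.
move=> SX GF FS; have [_ _ _ _ G3] := cgG.
have : [exists E, (E \in G) && (E :&: S == F :&: S)].
  by apply/existsP; exists F; rewrite GF eqxx.
case/existsP => E0 PE0.
have [E /maxsetP[/andP[GE /eqP ES] maxE] _] :=
  maxset_exists (P := fun E => (E \in G) && (E :&: S == F :&: S)) PE0.
have EX : E != X.
  by apply: contra FS => /eqP EX; rewrite -ES EX (setIidPr SX).
have [x /setDP[xX xE] GxE] := G3 E GE EX.
have [xS|xS] := boolP (x \in S).
  exists x, (x |: E); split=> //; last first.
    rewrite -ES setIUl; congr (_ :|: _).
    by apply/setIidPl; rewrite sub1set.
  rewrite inE xS andbT; apply: contra xE => xF.
  suff: x \in E :&: S by case/setIP.
  by rewrite ES inE xF.
case/negP: xE; rewrite -(maxE (x |: E)) ?setU11 ?subsetUr //.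
rewrite GxE -ES setIUl (_ : [set x] :&: S = set0) ?set0U ?eqxx //.
by apply/setP=> y; rewrite !inE; case: eqP => // ->; apply: negPf.
Qed.

Lemma cg_full : X \in G.
Proof.
have [_ GX G0 _ G3] := cgG.
have [E /maxsetP[GE maxE] _] := maxset_exists G0.
have [<- //|EX] := eqVneq E X.
have [x /setDP[_ xE] GxE] := G3 E GE EX.
by case/negP: xE; rewrite -(maxE _ GxE (subsetUr _ _)) setU11.
Qed.

(** A maximal closed set avoiding [x] can only be enlarged by [x] itself. This is
    how the anti-exchange property of hulls is used. *)
Lemma cg_avoid_max (F : {set T}) (x : T) :
  x \in X -> F \in G -> x \notin F ->
  exists E : {set T}, [/\ F \subset E, x \notin E, E \in G & x |: E \in G].
Proof.
move=> xX GF xF; have [_ _ _ _ G3] := cgG.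
have PF : (F \in G) && (x \notin F) by rewrite GF.
have [E /maxsetP[/andP[GE xE] maxE] FE] :=
  maxset_exists (P := fun E => (E \in G) && (x \notin E)) PF.
have EX : E != X by apply: contraNneq xE => ->.
have [y /setDP[_ yE] GyE] := G3 E GE EX.
exists E; split=> //; have [-> //|yx] := eqVneq x y.
case/negP: yE; rewrite -(maxE (y |: E)) ?setU11 ?subsetUr //.
by rewrite GyE !inE negb_or yx.
Qed.

Lemma cg_trace (S : {set T}) :
  S \subset X -> S != set0 -> convex_geometry S [set F :&: S | F in G].
Proof.
move=> SX S0; have [_ _ G0 GI _] := cgG.
split; first by [].
- by move=> _ /imsetP[F _ ->]; apply: subsetIr.
- by apply/imsetP; exists set0; rewrite // set0I.
- move=> _ _ /imsetP[F GF ->] /imsetP[H GH ->].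
  by apply/imsetP; exists (F :&: H); [apply: GI | rewrite -setIIl].
- move=> _ /imsetP[F GF ->] FS.
  have [x [E [/setDP[xS xF] GE ES]]] := cg_trace_step SX GF FS.
  exists x; first by rewrite !inE negb_and xF.
  by rewrite -ES; apply/imsetP; exists E.
Qed.

(** Enlarging the empty set inside [F :&: S] gives a single point. Closed sets are
    intersected with [F] to make this point the whole trace on [S]. *)
Lemma cg_point_in (F S : {set T}) :
  F \in G -> F :&: S != set0 ->
  exists2 x, x \in F :&: S & exists2 E, E \in G & E :&: S = [set x].
Proof.
move=> GF FS; have [_ GX G0 GI _] := cgG.
have FSX : F :&: S \subset X by apply: subset_trans (GX _ GF); apply: subsetIl.
have [|x [E [xFS GE EFS]]] := cg_trace_step FSX G0 _.
  by rewrite set0I eq_sym.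
exists x; first by move: xFS; rewrite setD0.
by exists (E :&: F); [apply: GI | rewrite -setIA EFS set0I setU0].
Qed.

Lemma cg_extreme_closed (A : {set T}) (x : T) :
  x \in A -> A :\ x \in G -> x \in cg_extreme G A.
Proof.
move=> xA GA; rewrite inE xA; apply/hullP => /(_ _ GA (subxx _)).
by rewrite !inE eqxx.
Qed.

End ConvexGeometry.

(** * Projections and fibers of a resolution *)

Section ResolutionProjection.
Variables (T : finType) (r : resolution T).

Lemma fiber_inj (x y : base r) z : z \in fiber x -> z \in fiber y -> x = y.
Proof.
move=> zx zy; apply: contraTeq isT => xy.
by have := disjointFr (fiber_disjoint xy) zx; rewrite zy.
Qed.

Lemma fiber_neq0 (x : base r) : exists z, z \in fiber x.
Proof. by apply/set0Pn; case: (fiber_geomP x). Qed.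

Lemma res_projP (A : {set T}) (x : base r) :
  reflect (exists2 z, z \in A & z \in fiber x) (x \in res_proj r A).
Proof.
rewrite inE.
apply: (iffP existsP) => [[z /andP[zA zx]]|[z zA zx]]; exists z => //.
by rewrite zA.
Qed.

Lemma mem_res_proj (A : {set T}) (x : base r) z :
  z \in A -> z \in fiber x -> x \in res_proj r A.
Proof. by move=> zA zx; apply/res_projP; exists z. Qed.

Lemma res_geomP (A : {set T}) :
  reflect [/\ A \subset res_ground r, res_proj r A \in base_geom r,
    forall x, x \in res_proj r A -> A :&: fiber x \in fiber_geom x
    & forall x, x \in res_proj r A ->
        x \notin cg_extreme (base_geom r) (res_proj r A) ->
        fiber x \subset A]
  (A \in res_geom r).
Proof.
rewrite inE; apply: (iffP and4P) => -[AZ R1 R2 R3]; split=> //.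
- by move=> x xA; apply: (implyP (forallP R2 x)).
- by move=> x xA xex; apply: (implyP (forallP R3 x)); rewrite inE xex.
- by apply/forallP => x; apply/implyP => /R2.
- by apply/forallP => x; apply/implyP => /setDP[xA xex]; apply: R3.
Qed.

End ResolutionProjection.

Section ExtremeFiber.
Variables (Z : finType) (G : {set {set Z}}) (r : resolution Z) (x : base r).
Hypothesis rG : res_equals r [set: Z] G.

Lemma fiber_V1 F : F \in G -> #|F :&: fiber x| = 1 -> F :|: fiber x \in G.
Proof.
case: rG => rZ <- /res_geomP[_ R1 R2 R3] F1.
have [z /setIP[zF zx]] : exists z, z \in F :&: fiber x.
  by apply/set0Pn; rewrite -card_gt0 F1.
have prF : res_proj r (F :|: fiber x) = res_proj r F.
  apply/setP=> y; apply/res_projP/res_projP => -[w wF wy]; last first.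
    by exists w; rewrite // inE wF.
  case/setUP: wF => [wF|wx]; first by exists w.
  by exists z; rewrite -?(fiber_inj wx wy).
apply/res_geomP; rewrite prF rZ; split=> //.
- move=> y yF; have [->|yx] := eqVneq y x.
    rewrite (setIidPr (subsetUr _ _)); apply: cg_full (fiber_geomP x).
  have xy0 : fiber x :&: fiber y = set0.
    by apply/eqP; rewrite setI_eq0 disjoint_sym fiber_disjoint.
  by rewrite setIUl xy0 setU0; apply: R2.
- by move=> y yF yex; apply: subset_trans (R3 y yF yex) (subsetUl _ _).
Qed.

(** The extreme point [x] can be removed from the whole base, so the projection
    of the set below is closed whether or not [H] meets the fiber of [x]; and
    (R3) asks nothing of that fiber, because [x] is extreme. *)
Lemma fiber_V2 H :
  x \in cg_extreme (base_geom r) [set: base r] ->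
  H \in G -> ~: fiber x :|: H :&: fiber x \in G.
Proof.
case: rG => rZ <-; rewrite inE in_setT /cg_hull -in_setC setC_bigcap.
case/bigcupP=> E /andP[GE EX]; rewrite in_setC => xE.
have {}EX : E = setT :\ x.
  by apply/eqP; rewrite eqEsubset EX subsetD1 subsetT xE.
move=> /res_geomP[_ R1 R2 R3]; set W := _ :|: _.
have WY y : y != x -> fiber y \subset W.
  move=> yx; apply: subset_trans (subsetUl _ _).
  by rewrite subsets_disjoint setCK fiber_disjoint.
have prW y : y != x -> y \in res_proj r W.
  move=> yx; have [z zy] := fiber_neq0 y.
  exact: mem_res_proj (subsetP (WY y yx) z zy) zy.
have WX : W :&: fiber x = H :&: fiber x.
  by apply/setP=> z; rewrite !inE; case: (z \in fiber x); rewrite ?andbF ?andbT.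
have prWx : res_proj r W :\ x = E.
  apply/setP=> y; rewrite EX !in_setD1 in_setT andbT.
  by case: eqP => //= /eqP/prW.
apply/res_geomP; rewrite rZ; split; first exact: subsetT.
- have [xW|xW] := boolP (x \in res_proj r W).
    rewrite -(setD1K xW) prWx EX setD1K ?in_setT //.
    exact: cg_full (base_geomP r).
  suff -> : res_proj r W = E by [].
  by rewrite -prWx; apply/esym/setDidPl; rewrite disjoint_sym disjoints1.
- move=> y /res_projP[z zW zy]; have [yx|yx] := eqVneq y x; last first.
    by rewrite (setIidPr (WY y yx)); apply: cg_full (fiber_geomP y).
  rewrite yx in zy *; rewrite WX; apply: R2; apply: mem_res_proj (zy).
  by have : z \in W :&: fiber x; [rewrite inE zW | rewrite WX => /setIP[]].
- move=> y; have [->|yx _ _] := eqVneq y x; last exact: WY.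
  by move=> xW; rewrite cg_extreme_closed // prWx.
Qed.
End ExtremeFiber.

(** * Contracting a set with the properties (V1) and (V2) *)

Section SqueezableSet.
Variables (Z : finType) (G : {set {set Z}}) (S : {set Z}).
Hypothesis cgG : convex_geometry [set: Z] G.
Hypothesis V1 : forall F, F \in G -> #|F :&: S| = 1 -> F :|: S \in G.
Hypothesis V2 : forall H, H \in G -> ~: S :|: H :&: S \in G.

(** (V1) only treats closed sets with a single point in [S]. Some point [s] of
    [F :&: S] is the trace on [S] of a closed set, and (V2) then provides a closed
    set which cuts [F] down to [s] inside [S] without changing it elsewhere. *)
Lemma saturated_closed F : F \in G -> F :&: S != set0 -> F :|: S \in G.
Proof.
move=> GF FS; have [_ _ _ GI _] := cgG.
have [s /setIP[sF sS] [E GE ES]] := cg_point_in cgG GF FS.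
have GFs : F :&: (~: S :|: E :&: S) \in G by apply: GI => //; apply: V2.
have -> : F :|: S = (F :&: (~: S :|: E :&: S)) :|: S.
  apply/setP=> z; rewrite !inE.
  by case: (z \in S); rewrite ?orbT // !orbF andbT.
apply: V1 => //; rewrite ES (_ : _ :&: S = [set s]) ?cards1 //.
apply/setP=> z; rewrite !inE; case: eqP => [->|_]; first by rewrite sF sS orbT.
by case: (z \in S); rewrite ?andbF.
Qed.

(** The contraction of [S] to the point [None]. *)
Definition squeeze (z : Z) : option {w : Z | w \notin S} := insub z.

Lemma squeeze_in z : (squeeze z == None) = (z \in S).
Proof. by rewrite /squeeze; case: insubP => [u /negPf->|/negPn->]. Qed.

Lemma squeeze_eq z w : z \notin S -> (squeeze w == squeeze z) = (w == z).
Proof.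
move=> zS; apply/eqP/eqP => [|-> //]; rewrite /squeeze.
case: insubP => [u _ uw|_]; case: insubP => [v _ vz|]; rewrite ?zS //.
by case=> uv; rewrite -uw uv vz.
Qed.

Lemma mem_squeeze (A : {set Z}) z :
  z \notin S -> (squeeze z \in squeeze @: A) = (z \in A).
Proof.
move=> zS; apply/imsetP/idP => [[w wA /eqP]|zA]; last by exists z.
by rewrite eq_sym squeeze_eq // => /eqP<-.
Qed.

Lemma None_squeeze (A : {set Z}) : (None \in squeeze @: A) = (A :&: S != set0).
Proof.
apply/imsetP/set0Pn => [[w wA /esym/eqP]|[w /setIP[wA wS]]].
  by rewrite squeeze_in => wS; exists w; rewrite inE wA.
by exists w => //; apply/esym/eqP; rewrite squeeze_in.
Qed.

Hypothesis S0 : S != set0.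

Lemma squeeze_surj x : exists z, squeeze z = x.
Proof.
case: x => [[z zS]|]; first by exists z; rewrite /squeeze insubT.
by have [z zS] := set0Pn _ S0; exists z; apply/eqP; rewrite squeeze_in.
Qed.

Lemma squeeze_saturate (F : {set Z}) :
  None \in squeeze @: F -> squeeze @: (F :|: S) = squeeze @: F.
Proof.
move=> FS; apply/setP=> x; have [z <-] := squeeze_surj x.
have [zS|zS] := boolP (z \in S); last first.
  by rewrite !mem_squeeze // inE (negPf zS) orbF.
have /eqP-> : squeeze z == None by rewrite squeeze_in.
rewrite FS None_squeeze; apply/set0Pn; exists z.
by rewrite !inE zS orbT.
Qed.

(** Images commute with intersections unless both sets meet [S] in disjoint
    traces. Saturation with [S] achieves the second alternative. *)
Lemma squeeze_setI (A B : {set Z}) :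
  (A :&: S = set0 \/ S \subset B) ->
  squeeze @: (A :&: B) = squeeze @: A :&: squeeze @: B.
Proof.
move=> AB; apply/setP=> x; have [z <-] := squeeze_surj x; rewrite inE.
have [zS|zS] := boolP (z \in S); last by rewrite !mem_squeeze // inE.
have /eqP-> : squeeze z == None by rewrite squeeze_in.
rewrite !None_squeeze; case: AB => [A0|SB].
  by rewrite setIAC A0 set0I eqxx.
by rewrite -setIA (setIidPr SB) S0 andbT.
Qed.

Definition squeezed : {set {set option {w : Z | w \notin S}}} :=
  [set squeeze @: (F : {set Z}) | F in G].

Lemma squeezed_cg : convex_geometry [set: option {w : Z | w \notin S}] squeezed.
Proof.
have [_ _ G0 GI G3] := cgG; split.
- by apply/set0Pn; exists None; rewrite inE.
- by move=> F _; apply: subsetT.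
- by apply/imsetP; exists set0; rewrite ?imset0.
- move=> _ _ /imsetP[A GA ->] /imsetP[B GB ->].
  have [/eqP AS|AS] := boolP (A :&: S == set0).
    rewrite -squeeze_setI; last by left.
    by apply/imsetP; exists (A :&: B); rewrite ?GI.
  have [/eqP BS|BS] := boolP (B :&: S == set0).
    rewrite setIC -squeeze_setI; last by left.
    by apply/imsetP; exists (B :&: A); rewrite ?GI.
  rewrite -(@squeeze_saturate B) ?None_squeeze // -squeeze_setI.
    by apply/imsetP; exists (A :&: (B :|: S)); rewrite ?GI // saturated_closed.
  by right; apply: subsetUr.
- move=> _ /imsetP[A GA ->] AX.
  (* Replacing A by A :|: S if needed, a point added to B has a new image. *)
  have [B [GB AB SB]] : exists B : {set Z},
      [/\ B \in G, squeeze @: A = squeeze @: B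
        & B :&: S = set0 \/ S \subset B].
    have [/eqP AS|AS] := boolP (A :&: S == set0).
      by exists A; split=> //; left.
    exists (A :|: S); split; first exact: saturated_closed.
      by rewrite squeeze_saturate ?None_squeeze.
    by right; apply: subsetUr.
  have BX : B != setT.
    apply: contraNneq AX => BT; rewrite AB BT eqEsubset subsetT /=.
    by apply/subsetP=> x _; have [z <-] := squeeze_surj x; rewrite imset_f.
  have [z /setDP[_ zB] GzB] := G3 B GB BX.
  exists (squeeze z).
    rewrite !inE andbT AB.
    have [zS|zS] := boolP (z \in S); last by rewrite mem_squeeze.
    have /eqP-> : squeeze z == None by rewrite squeeze_in.
    rewrite None_squeeze negbK; case: SB => [-> //|/subsetP/(_ z zS)].
    by rewrite (negPf zB).
  by rewrite AB -imsetU1; apply/imsetP; exists (z |: B).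
Qed.

Definition squeeze_fiber x : {set Z} := squeeze @^-1: [set x].

Lemma squeeze_fiber_cg x :
  convex_geometry (squeeze_fiber x) [set F :&: squeeze_fiber x | F in G].
Proof.
apply: (cg_trace cgG (subsetT _)); apply/set0Pn.
by have [z zx] := squeeze_surj x; exists z; rewrite !inE zx.
Qed.

Lemma squeeze_fiber_disjoint x y :
  x != y -> [disjoint squeeze_fiber x & squeeze_fiber y].
Proof.
move=> xy; rewrite -setI_eq0; apply/eqP/setP=> z; rewrite !inE.
by apply: contraNF xy => /andP[/eqP<- /eqP<-].
Qed.

Definition squeeze_resolution : resolution Z :=
  Resolution squeezed_cg squeeze_fiber_cg squeeze_fiber_disjoint.

Lemma squeeze_fiber_None : squeeze_fiber None = S.
Proof. by apply/setP=> z; rewrite !inE squeeze_in. Qed.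

Lemma squeeze_proj (A : {set Z}) : res_proj squeeze_resolution A = squeeze @: A.
Proof.
apply/setP=> x; rewrite inE; apply/existsP/imsetP => [[z /andP[zA]]|[z zA ->]].
  by rewrite !inE => /eqP<-; exists z.
by exists z; rewrite zA !inE eqxx.
Qed.

Lemma squeeze_ground : res_ground squeeze_resolution = [set: Z].
Proof.
by apply/setP=> z; rewrite inE; apply/bigcupP; exists (squeeze z); rewrite ?inE.
Qed.

(** A set [A] in the resolution has the projection of some closed [F], and its
    trace on [S] is that of some closed [H]. If [A] meets [S], it is recovered as
    the intersection of [F :|: S] with the set that (V2) makes from [H]. *)
Lemma squeeze_res_geom : res_geom squeeze_resolution = G.
Proof.
have [_ _ G0 GI _] := cgG.
apply/setP=> A; apply/res_geomP/idP; rewrite squeeze_ground squeeze_proj /=.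
  case=> _ /imsetP[F GF AF] R2 _.
  have [NA|NA] := boolP (None \in squeeze @: A); last first.
    suff -> : A = F by [].
    apply/setP=> z; have [zS|zS] := boolP (z \in S).
      have noS (B : {set Z}) : None \notin squeeze @: B -> z \notin B.
        apply: contraNN => zB; rewrite None_squeeze; apply/set0Pn; exists z.
        by rewrite inE zB.
      by rewrite (negPf (noS _ NA)) (negPf (noS F _)) // -AF.
    by rewrite -mem_squeeze // AF mem_squeeze.
  have /imsetP[H GH] := R2 None NA.
  rewrite squeeze_fiber_None => AHS.
  have GFS : F :|: S \in G.
    by apply: saturated_closed => //; rewrite -None_squeeze -AF.
  have -> : A = (F :|: S) :&: (~: S :|: H :&: S).
    apply/setP=> z; have [zS|zS] := boolP (z \in S).
      by have /setP/(_ z) := AHS; rewrite !inE zS orbT !andbT.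
    rewrite -mem_squeeze // AF mem_squeeze //.
    by rewrite !inE zS (negPf zS) orbF orTb andbT.
  by apply: GI => //; apply: V2.
move=> GA; split.
- exact: subsetT.
- by apply/imsetP; exists A.
- by move=> x _; apply/imsetP; exists A.
move=> x xA; have [w wA xw] := imsetP xA; have [wS|wS] := boolP (w \in S).
  have xN : x = None by apply/eqP; rewrite xw squeeze_in.
  (* Removing S from A by (V2) shows that the point None is extreme. *)
  case/negP; rewrite xN in xA *; apply: cg_extreme_closed => //.
  apply/imsetP; exists (A :&: (~: S :|: set0 :&: S)); first by rewrite GI ?V2.
  apply/setP=> y; have [z <-] := squeeze_surj y.
  rewrite in_setD1 squeeze_in.
  have [zS|zS] := boolP (z \in S); last first.
    by rewrite !mem_squeeze // !inE zS orTb andbT.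
  have /eqP-> : squeeze z == None by rewrite squeeze_in.
  rewrite !None_squeeze set0I setU0; apply/esym.
  by rewrite -setIA (setIC (~: S)) setICr setI0 eqxx.
by move=> _; apply/subsetP=> z; rewrite !inE xw squeeze_eq // => /eqP->.
Qed.

End SqueezableSet.

(** * Resolutions of geometries with exchange *)

Section ExchangeResolution.
Variables (Z : finType) (G : {set {set Z}}) (r : resolution Z).
Hypothesis rG : res_equals r [set: Z] G.
Hypothesis G1 : forall t, [set t] \in G.
Hypothesis Gexch : forall (B : {set Z}) (s t : Z),
  s \in cg_hull G B -> t \in cg_hull G B ->
  exists2 b, b \in B & s \in cg_hull G (t |: B :\ b).

(** A closed set containing a point [z a] over each [a] in [A] has [A], hence [x],
    in its projection, where [x] is not extreme; so (R3) applies to the fiber of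
    [x]. *)
Lemma fiber_sub_hull (x : base r) (A : {set base r}) (z : base r -> Z) :
  (forall y, z y \in fiber y) ->
  x \notin A -> x \in cg_hull (base_geom r) A ->
  fiber x \subset cg_hull G (z @: A).
Proof.
move=> zP xA /hullP xhA; have [_ <-] := rG.
apply/subsetP => s sx; apply/hullP => F /res_geomP[_ R1 _ R3] /subsetP BF.
have Apr : A \subset res_proj r F.
  by apply/subsetP => a aA; apply: mem_res_proj (zP a); apply/BF/imset_f.
have xF : x \in res_proj r F by apply: xhA.
apply: (subsetP (R3 x xF _)) sx; rewrite inE xF negbK; apply/hullP => E GE FE.
by apply: xhA => //; apply: subset_trans FE; rewrite subsetD1 Apr.
Qed.

(** Two points [s] and [t] over a non-extreme point [x] would have to coincide,
    by exchanging [t] with one of the points that span [s] and comparing with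
    the closed set [W] whose only point over [x] is [t]. *)
Lemma exchange_res_extreme : res_extreme r.
Proof.
move=> x; rewrite inE in_setT negbK => xhull.
have [rZ rGeq] := rG; have [z zP] := choice (@fiber_neq0 _ r).
apply/eqP; apply: contraT => fx1.
have [s sx] := fiber_neq0 x.
have [t /setD1P[ts tx]] : exists t, t \in fiber x :\ s.
  apply/set0Pn; apply: contra fx1 => /eqP fx0.
  by rewrite (cardsD1 s) sx fx0 cards0.
pose P (A : {set base r}) := (x \notin A) && (x \in cg_hull (base_geom r) A).
have PT : P (setT :\ x) by rewrite /P xhull !inE eqxx.
have [A /minsetP[/andP[xA xhA] minA] _] := minset_exists PT.
have /subsetP fxh := fiber_sub_hull zP xA xhA.
have [_ /imsetP[a aA ->] sh] := Gexch (fxh s sx) (fxh t tx).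
have [F [GF AF xF]] :
    exists F : {set base r},
      [/\ F \in base_geom r, A :\ a \subset F & x \notin F].
  have : x \notin cg_hull (base_geom r) (A :\ a).
    apply/negP => xh.
    have PA : P (A :\ a) by rewrite /P !inE (negPf xA) andbF xh.
    by move: aA; rewrite -(minA _ PA (subsetDl _ _)) !inE eqxx.
  rewrite -in_setC setC_bigcap => /bigcupP[F /andP[GF AF]].
  by rewrite in_setC => xF; exists F.
have [E [FE xE GE GxE]] := cg_avoid_max (base_geomP r) (in_setT x) GF xF.
pose W := [set w | [exists y in E, w \in fiber y]] :|: [set t].
have WE y w : y \in E -> w \in fiber y -> w \in W.
  move=> yE wy; rewrite !inE; apply/orP; left.
  by apply/existsP; exists y; rewrite yE.
have xW w : w \in W -> w \in fiber x -> w = t.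
  rewrite !inE => /orP[/existsP[y /andP[yE wy]] wx|/eqP //].
  by rewrite -(fiber_inj wy wx) yE in xE.
have Wpr : res_proj r W = x |: E.
  apply/setP => y; apply/res_projP/setU1P => [[w wW wy]|[->|yE]].
  - move: wW; rewrite !inE => /orP[/existsP[u /andP[uE wu]]|/eqP wt].
      by right; rewrite (fiber_inj wy wu).
    by left; apply: (fiber_inj wy); rewrite wt.
  - by exists t; rewrite // !inE eqxx orbT.
  - by exists (z y) => //; apply: WE (zP y).
have GW : W \in G.
  rewrite -rGeq; apply/res_geomP; rewrite Wpr; split=> //.
  - by rewrite rZ subsetT.
  - move=> y /setU1P[->|yE].
      have := G1 t; rewrite -rGeq => /res_geomP[_ _ R2 _].
      suff -> : W :&: fiber x = [set t] :&: fiber x.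
        by apply: R2; apply: mem_res_proj (set11 t) tx.
      apply/setP => w; rewrite !in_setI; have [wx|] := boolP (w \in fiber x).
        rewrite !andbT; apply/idP/set1P => [wW|->]; first exact: xW.
        by rewrite !inE eqxx orbT.
      by rewrite !andbF.
    have /setIidPr-> : fiber y \subset W by apply/subsetP => w; apply: WE.
    exact: cg_full (fiber_geomP y).
  - move=> y /setU1P[->|yE]; last by move=> _; apply/subsetP => w; apply: WE.
    by rewrite (cg_extreme_closed (setU11 x E)) ?setU1K.
have sW : s \in W.
  apply: (elimT (hullP _ _ _) sh) => //; apply/subsetP => w /setU1P[->|].
    by rewrite !inE eqxx orbT.
  case/setD1P => wza /imsetP[b bA wb]; subst w.
  apply: (WE b) (zP b); apply: (subsetP (subset_trans AF FE)).
  by rewrite !inE bA andbT; apply: contraNneq wza => ->.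
by rewrite (xW s sW sx) eqxx in ts.
Qed.
End ExchangeResolution.

(** * Affine geometries *)

Section Affine.
Import Order.TTheory GRing.Theory Num.Theory.
Local Open Scope ring_scope.

(** Convexity in terms of real weights instead of elements of the unit interval
    type. *)
Lemma convex_setP (R : realType) (E : lmodType R) (C : classical_sets.set E) :
  convex_set C <->
  forall x y (a : R), 0 <= a <= 1 -> C x -> C y -> C (a *: x + (1 - a) *: y).
Proof.
split=> [cC x y a /andP[a0 a1] Cx Cy|cC x y a].
  by have := cC x y (Itv01 a0 a1); rewrite !classical_sets.in_setE; apply.
rewrite !classical_sets.in_setE => Cx Cy; apply: cC => //.
by apply/andP; split; [exact: ge0 | exact: le1].
Qed.

Lemma convex_set_sum (R : realType) (E : lmodType R) (C : classical_sets.set E)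
    (I : finType) (w : I -> R) (p : I -> E) :
  convex_set C -> (forall i, 0 <= w i) -> \sum_i w i = 1 ->
  (forall i, 0 < w i -> C (p i)) -> C (\sum_i w i *: p i).
Proof.
move=> /convex_setP cC w0 w1 Cp.
(* K v s: the partial sum v is s times a point of C, s being the sum of the
   weights used so far; the point is arbitrary while s = 0. *)
pose K (v : E) (s : R) :=
  0 <= s /\ exists c, v = s *: c /\ (0 < s -> C c).
have: K (\sum_i w i *: p i) (\sum_i w i).
  apply: big_rec2 => [|i v s _ [s0 [c [-> Cc]]]].
    by split=> //; exists 0; rewrite scale0r ltxx.
  have := w0 i; rewrite le_eqVlt => /predU1P[<-|wi].
    by rewrite scale0r !add0r; split=> //; exists c.
  split; first exact: addr_ge0.
  have t0 : 0 < w i + s by rewrite ltr_wpDr.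
  have [s00|sp] := eqVneq s 0.
    by exists (p i); rewrite s00 scale0r !addr0; split=> // _; exact: Cp.
  have Es : 1 - w i / (w i + s) = s / (w i + s) by field; rewrite gt_eqF.
  exists ((w i / (w i + s)) *: p i + (1 - w i / (w i + s)) *: c).
  split=> [|_].
    by rewrite scalerDr !scalerA Es ![(w i + s) * _]mulrC !divfK ?gt_eqF.
  apply: cC; [|exact: Cp|by apply: Cc; rewrite lt_neqAle eq_sym sp].
  by rewrite divr_ge0 ?(ltW t0)//= ler_pdivrMr // mul1r lerDl.
by rewrite w1 => -[_ [c [->]]]; rewrite scale1r; apply.
Qed.

Lemma affine_coordinates (R : realType) (T : finType) (G : {set {set T}}) :
  affine_geometry R G ->
  exists (d : nat) (p : T -> 'rV[R]_d), injective p /\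
    forall A, A \in G <->
      exists2 C : classical_sets.set 'rV[R]_d,
        convex_set C & forall z, z \in A <-> C (p z).
Proof.
move=> [d [P [_ [s bs sG]]]]; have injs := bij_inj bs.
exists d, (fun z => val (s z)); split=> [x y /val_inj /injs //|A].
rewrite sG inE; split=> [/asboolP[C cC sA]|[C cC AC]].
  exists C => // z; rewrite -(mem_imset A _ injs) sA inE.
  by split=> /asboolP.
apply/asboolP; exists C => //; apply/setP=> p; rewrite inE.
have [t _ ts] := bs; rewrite -(ts p) (mem_imset A _ injs).
by apply/idP/asboolP => /AC.
Qed.

Section AffineHull.
Variables (R : realType) (T : finType) (G : {set {set T}}).
Variables (d : nat) (p : T -> 'rV[R]_d).
Hypothesis pG : forall A, A \in G <->
  exists2 C : classical_sets.set 'rV[R]_d,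
    convex_set C & forall z, z \in A <-> C (p z).

Definition weights_on (B : {set T}) (w : T -> R) : Prop :=
  [/\ forall b, 0 <= w b, \sum_b w b = 1 & forall b, 0 < w b -> b \in B].

Lemma affine_hullP (B : {set T}) (z : T) :
  z \in cg_hull G B <->
  exists2 w, weights_on B w & p z = \sum_b w b *: p b.
Proof.
split=> [/hullP zB|[w [w0 w1 wB] pz]]; last first.
  apply/hullP=> F /pG[C cC FC] /subsetP BF; apply/FC; rewrite pz.
  by apply: convex_set_sum => // b /wB /BF /FC.
pose C (v : 'rV[R]_d) := exists2 w, weights_on B w & v = \sum_b w b *: p b.
have CG : [set y | `[< C (p y) >]] \in G.
  apply/pG; exists C => [|y]; last by rewrite inE; split=> /asboolP.
  apply/convex_setP => _ _ a /andP[a0 a1] [w [w0 w1 wB] ->] [u [u0 u1 uB] ->].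
  have a1' : 0 <= 1 - a by rewrite subr_ge0.
  exists (fun b => a * w b + (1 - a) * u b); first split.
  - by move=> b; rewrite addr_ge0 ?mulr_ge0.
  - by rewrite big_split -!mulr_sumr /= w1 u1; ring.
  - move=> b; apply: contraLR => bB.
    have -> : w b = 0.
      by apply/le_anti; rewrite w0 andbT leNgt; apply: contra bB => /wB.
    have -> : u b = 0.
      by apply/le_anti; rewrite u0 andbT leNgt; apply: contra bB => /uB.
    by rewrite !mulr0 addr0 ltxx.
  - rewrite !scaler_sumr -big_split; apply: eq_bigr => b _ /=.
    by rewrite !scalerA -scalerDl.
have /(zB _ CG) : B \subset [set y | `[< C (p y) >]].
  apply/subsetP=> b bB; rewrite inE; apply/asboolP.
  exists (fun c => (c == b)%:R); first split.
  - by move=> c; rewrite ler0n.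
  - by rewrite (bigD1 b) //= eqxx big1 ?addr0 // => c /negPf->.
  - by move=> c; case: eqP => [->//|_]; rewrite ltxx.
  - rewrite (bigD1 b) //= eqxx scale1r big1 ?addr0 // => c /negPf->.
    exact: scale0r.
by rewrite inE => /asboolP.
Qed.

Lemma affine_singleton (t : T) : injective p -> [set t] \in G.
Proof.
move=> injp; apply/pG; exists (fun v => v = p t) => [|z].
  by apply/convex_setP => _ _ a _ -> ->; rewrite -scalerDl addrC subrK scale1r.
by rewrite inE; split=> [/eqP->|/injp->].
Qed.

(** With [s] and [t] written as combinations of [B] with weights [a] and [c],
    subtract from the first as large a multiple [l] of the second as keeps all
    coefficients nonnegative. The coefficient of some [b] vanishes, and what
    remains writes [s] as a combination of [t] and [B :\ b]. *)
Lemma affine_exchange (B : {set T}) (s t : T) :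
  s \in cg_hull G B -> t \in cg_hull G B ->
  exists2 b, b \in B & s \in cg_hull G (t |: B :\ b).
Proof.
move=> /affine_hullP[a [a0 a1 aB] ps] /affine_hullP[c [c0 c1 cB] pt].
have [b0 cb0] : exists b, 0 < c b.
  apply/existsP; apply: contraT; rewrite negb_exists => /forallP c_le0.
  have := ltr01 (R := R); rewrite -c1 ltNge sumr_le0 // => b _.
  by rewrite leNgt c_le0.
case: (@arg_minP _ _ _ b0 (fun b => 0 < c b) (fun b => a b / c b) cb0)
  => b cb b_min.
exists b; first exact: cB.
set l := a b / c b in b_min.
have l0 : 0 <= l by rewrite divr_ge0.
have ac x : 0 <= a x - l * c x.
  have := c0 x; rewrite le_eqVlt => /predU1P[<-|cx].
    by rewrite mulr0 subr0.
  by rewrite subr_ge0 -ler_pdivlMr ?b_min.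
apply/affine_hullP.
exists (fun x => l * (x == t)%:R + (a x - l * c x)); first split.
- by move=> x; rewrite addr_ge0 // mulr_ge0.
- rewrite big_split sumrB -!mulr_sumr /= a1 c1.
  rewrite (bigD1 t) //= eqxx big1 => [|x /negPf->//].
  by rewrite addr0 mulr1 addrC subrK.
- move=> x; rewrite !inE; case: eqVneq => //= xt; rewrite mulr0 add0r.
  case: eqVneq => [->|_ pos]; first by rewrite /l divfK ?gt_eqF // subrr ltxx.
  apply: aB; apply: lt_le_trans pos _.
  by rewrite gerBl mulr_ge0.
- under eq_bigr do rewrite scalerDl scalerBl -!scalerA.
  rewrite big_split sumrB -!scaler_sumr /= -ps -pt (bigD1 t) //= eqxx scale1r.
  by rewrite big1 ?addr0 => [|x /negPf->]; rewrite ?scale0r // addrC subrK.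
Qed.

End AffineHull.

End Affine.

(** * The equivalence *)

Theorem corollary4p6 (R : realType) (Z : finType) (GZ : {set {set Z}})
    (GZ_cg : convex_geometry [set: Z] GZ) (GZ_affine : affine_geometry R GZ) :
  [<-> resolvable [set: Z] GZ;
       exists S : {set Z}, shrinkable [set: Z] GZ S;
       exists S : {set Z}, extremely_shrinkable [set: Z] GZ S;
       exists S : {set Z},
         [/\ 1 < #|S| < #|Z|,
             forall G, G \in GZ -> #|G :&: S| = 1 -> G :|: S \in GZ
           & forall H, H \in GZ -> (~: S) :|: (H :&: S) \in GZ]].
Proof.
tfae.
- move=> [r [rG r_nontriv]]; have [_ [x fx]] := r_nontriv.
  by exists (fiber x); split=> //; exists r; split=> //; exists x.
- move=> [S [S2 [r [rG r_nontriv rS]]]]; exists S; split=> //; exists r.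
  split=> //; have [d [p [injp pG]]] := affine_coordinates GZ_affine.
  apply: (exchange_res_extreme rG) => [t|B s t].
    exact: (affine_singleton pG).
  exact: (affine_exchange pG).
- move=> [S [S2 [r [rG [r2 _] r_ext [x Sx]]]]]; exists S; subst S.
  have x_ext : x \in cg_extreme (base_geom r) setT.
    by apply: contraT => /r_ext fx1; rewrite fx1 in S2.
  split=> [|F|H]; [|exact: fiber_V1|exact: fiber_V2].
  rewrite S2 -cardsT proper_card // properT.
  have [y yx] : exists y, y != x.
    have /card_gt0P[y] : 0 < #|[set: base r] :\ x|.
      by move: r2; rewrite -cardsT (cardsD1 x) in_setT.
    by rewrite !inE andbT; exists y.
  have [z zy] := fiber_neq0 y; apply: contra yx => /eqP fxT.
  by rewrite (@fiber_inj _ r y x z) // fxT.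
- move=> [S [/andP[S2 SZ] V1 V2]].
  have S0 : S != set0 by rewrite -card_gt0 ltnW.
  exists (squeeze_resolution GZ_cg V1 V2 S0); split.
    by split; [exact: squeeze_ground | exact: squeeze_res_geom].
  split; last by exists None; rewrite /= squeeze_fiber_None.
  have [z zS] : exists z, z \notin S.
    apply/existsP; rewrite -negb_forall; apply: contraTN SZ => /forallP SZ.
    by rewrite -leqNgt subset_leq_card //; apply/subsetP.
  by rewrite /= card_option ltnS; apply/card_gt0P; exists (exist _ z zS).
Qed.
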